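(* Let $f:\mathbb{R}^N\to\mathbb{R}$ be continuously differentiable, let $C>0$ be such that $f(\theta)>-C$ for all $\theta\in\mathbb{R}^N$, and let $\mathcal{L}:\mathbb{R}^N\to\mathbb{R}^N$ be a self-adjoint linear operator. Let $\delta t>0$ be arbitrary, and let $(\theta_k,r_k)_{k\ge 0}\subset \mathbb{R}^N\times\mathbb{R}$, with $r_0=\sqrt{f(\theta_0)+C}$, satisfy for every $k\ge 0$ the scheme $$\frac{\theta_{k+1}-\theta_k}{\delta t}+\mathcal{L}\theta_{k+1}+\frac{\nabla f(\theta_k)}{\sqrt{f(\theta_k)+C}}\,r_{k+1}-\mathcal{L}\theta_k=0,$$ $$\frac{r_{k+1}-r_k}{\delta t}=\left(\frac{\nabla f(\theta_k)}{2\sqrt{f(\theta_k)+C}},\ \frac{\theta_{k+1}-\theta_k}{\delta t}\right).$$ If $\mathcal{L}$ is non-negative, then for any $\delta t>0$ the modified energy $r^2$ is unconditionally diminishing, in the sense that for every $k\ge 0$ $$r_{k+1}^2-r_k^2=-\frac{1}{\delta t}\|\theta_{k+1}-\theta_k\|^2-\big(\mathcal{L}(\theta_{k+1}-\theta_k),\,\theta_{k+1}-\theta_k\big)-(r_{k+1}-r_k)^2 .$$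
   Context: $(\cdot,\cdot)$ and $\|\cdot\|$ denote the Euclidean ($l^2$) inner product and norm on $\mathbb{R}^N$. ''Non-negative'' means $(\mathcal{L}x,x)\ge 0$ for all $x\in\mathbb{R}^N$. *)

(* Defs.v *)
(* R^N is represented by the row vectors 'rV[R]_N. *)
From HB Require Import structures.
From mathcomp Require Import all_boot all_order all_algebra.
From mathcomp Require Import all_classical all_reals all_analysis.
Import Order.TTheory GRing.Theory Num.Theory.
Import numFieldNormedType.Exports.

Set Implicit Arguments.
Unset Strict Implicit.
Unset Printing Implicit Defensive.

Local Open Scope classical_set_scope.
Local Open Scope ring_scope.

Definition dot (R : realType) (N : nat) (u v : 'rV[R]_N) : R :=
  \sum_(i < N) u 0 i * v 0 i.

(* The library norm `|u| on 'rV[R]_N is the sup norm, hence a separate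
   Euclidean norm; the topologies, and so continuity and differentiability,
   are the same for both. *)
Definition l2norm (R : realType) (N : nat) (u : 'rV[R]_N) : R :=
  Num.sqrt (dot u u).

Definition grad (R : realType) (N : nat) (f : 'rV[R]_N -> R) (x : 'rV[R]_N) :
    'rV[R]_N :=
  \row_(i < N) 'D_(delta_mx 0 i) f x.

(* Differentiability is required separately because 'D_v f x is a total
   operator, with an unspecified value where the derivative does not exist. *)
Definition continuously_differentiable (R : realType) (N : nat)
    (f : 'rV[R]_N -> R) : Prop :=
  (forall x, differentiable f x) /\ continuous (grad f).

Definition self_adjoint (R : realType) (N : nat) (L : 'rV[R]_N -> 'rV[R]_N) :
    Prop :=
  forall x y, dot (L x) y = dot x (L y).

Definition non_negative (R : realType) (N : nat) (L : 'rV[R]_N -> 'rV[R]_N) :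
    Prop :=
  forall x, 0 <= dot (L x) x.

(* Main.v *)
(* Pair the first scheme equation with the increment d of theta. With
   g = grad f / sqrt (f + C), the second equation says (g, d) = 2 (r' - r), so
   the nonlinear term contributes 2 r' (r' - r) = r'^2 - r^2 + (r' - r)^2. *)
Require Import Defs.
From HB Require Import structures.
From mathcomp Require Import all_boot all_order all_algebra.
From mathcomp Require Import all_classical all_reals all_analysis.
From mathcomp Require Import lra.
Import Order.TTheory GRing.Theory Num.Theory.
Import numFieldNormedType.Exports.

Local Open Scope ring_scope.

Lemma dotDl (R : realType) (N : nat) (u v w : 'rV[R]_N) :
  dot (u + v) w = dot u w + dot v w.
Proof. by rewrite -big_split; apply: eq_bigr => i _; rewrite mxE mulrDl. Qed.

Lemma dotZl (R : realType) (N : nat) (a : R) (u v : 'rV[R]_N) :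
  dot (a *: u) v = a * dot u v.
Proof. by rewrite /dot mulr_sumr; apply: eq_bigr => i _; rewrite mxE mulrA. Qed.

Lemma dotC (R : realType) (N : nat) (u v : 'rV[R]_N) : dot u v = dot v u.
Proof. by apply: eq_bigr => i _; rewrite mulrC. Qed.

Lemma dot0l (R : realType) (N : nat) (u : 'rV[R]_N) : dot 0 u = 0.
Proof. by apply: big1 => i _; rewrite mxE mul0r. Qed.

Lemma dot_ge0 (R : realType) (N : nat) (u : 'rV[R]_N) : 0 <= dot u u.
Proof. by apply: sumr_ge0 => i _; rewrite -expr2 sqr_ge0. Qed.

(** [Num.sqrt] returns 0 on negative arguments, so squaring undoes it because [dot u u] is
    non-negative. *)
Lemma l2norm_sqr (R : realType) (N : nat) (u : 'rV[R]_N) :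
  l2norm u ^+ 2 = dot u u.
Proof. by rewrite sqr_sqrtr // dot_ge0. Qed.

Theorem theorem1 (R : realType) (N : nat) (f : 'rV[R]_N -> R) (C : R)
    (L : {linear 'rV[R]_N -> 'rV[R]_N}) (dt : R)
    (theta : nat -> 'rV[R]_N) (r : nat -> R)
    (hf : continuously_differentiable f)
    (hC : 0 < C)
    (hfC : forall x : 'rV[R]_N, - C < f x)
    (hL : self_adjoint L)
    (hdt : 0 < dt)
    (hr0 : r 0%N = Num.sqrt (f (theta 0%N) + C))
    (htheta : forall k : nat,
        dt^-1 *: (theta k.+1 - theta k) + L (theta k.+1)
        + r k.+1 *: ((Num.sqrt (f (theta k) + C))^-1 *: grad f (theta k))
        - L (theta k) = 0)
    (hr : forall k : nat,
        (r k.+1 - r k) / dt =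
        dot ((2 * Num.sqrt (f (theta k) + C))^-1 *: grad f (theta k))
            (dt^-1 *: (theta k.+1 - theta k)))
    (hLpos : non_negative L) :
  forall k : nat,
    r k.+1 ^+ 2 - r k ^+ 2 =
      - (dt^-1 * l2norm (theta k.+1 - theta k) ^+ 2)
      - dot (L (theta k.+1 - theta k)) (theta k.+1 - theta k)
      - (r k.+1 - r k) ^+ 2
    /\ r k.+1 ^+ 2 <= r k ^+ 2.
Proof.
move=> k; move: (htheta k) (hr k).
(* The implicit and explicit [L] terms merge by linearity into [L] of the increment. *)
rewrite addrAC -(addrA _ (L _) (- L _)) -linearB l2norm_sqr.
set d := theta k.+1 - theta k; set s := Num.sqrt _; set g := s^-1 *: _ => e1 e2.
have gd : dot g d = 2 * (r k.+1 - r k).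
  (* The factors 1/2 and 1/dt come out of the inner product; 1/dt then cancels from both sides. *)
  move: e2; rewrite invfM -scalerA -/g dotZl dotC dotZl dotC mulrCA mulrC.
  have dt0 : dt^-1 != 0 by rewrite invr_neq0 // gt_eqF.
  by move=> /(mulfI dt0) ->; rewrite mulrA mulfV ?mul1r ?pnatr_eq0.
(* Made opaque so that expanding by bilinearity splits neither the difference [d] nor the multiple
   [g]. *)
clearbody d g.
have pairing := congr1 (fun v => dot v d) e1.
rewrite !dotDl !dotZl gd dot0l in pairing.
(* Linear in [pairing] once the monomials in [r k.+1] and [r k] are atoms: 2r'(r' - r) = r'^2 - r^2
   + (r' - r)^2. *)
have energy : r k.+1 ^+ 2 - r k ^+ 2 =
    - (dt^-1 * dot d d) - dot (L d) d - (r k.+1 - r k) ^+ 2 by lra.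
(* The change in r^2 is minus a sum of three non-negative terms, by [hdt], by [hLpos] and as a
   square. *)
split=> //; rewrite -subr_le0 energy -!opprD oppr_le0.
by rewrite !addr_ge0 ?sqr_ge0 ?hLpos // mulr_ge0 ?dot_ge0 // invr_ge0 ltW.
Qed.
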